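(* Let $\Omega\subset\mathbb{R}^d$ be open and connected, $m\ge1$, $p\colon\Omega\to[1,2]$ measurable, $X=L^2(\Omega,\mathbb{R}^m)$, $\rho_p(f)=\int_\Omega|f(x)|^{p(x)}\,dx$, and $\tau>0$. Then for every $f\in X$ and almost every $x\in\Omega$, $$\operatorname{prox}_{\tau\rho_p^*}(f)(x)=V_\tau\big(f(x),p(x)\big)\,\frac{f(x)}{|f(x)|},$$ with the convention that the value is $0$ if $f(x)=0$, where $$V_\tau(z,q)=\begin{cases}\min\{|z|,1\}, & q=1,\\ \frac{2|z|}{\tau+2}, & q=2,\\ |z|-\bar\alpha(|z|,q,\tau^{1-q}), & 1<q<2,\end{cases}$$ and, for $a>0$ and $s>0$, $\bar\alpha(a,q,s)$ denotes the unique solution $\alpha\in(0,a)$ of $\alpha+s\,q\,\alpha^{q-1}=a$. *)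

(* Defs.v *)
From HB Require Import structures.
From mathcomp Require Import all_boot all_order all_algebra.
From mathcomp Require Import all_classical all_reals all_analysis.

Set Implicit Arguments.
Unset Strict Implicit.
Unset Printing Implicit Defensive.

Import Order.TTheory GRing.Theory Num.Theory.
Import numFieldNormedType.Exports.
Local Open Scope classical_set_scope.
Local Open Scope ring_scope.

(* Lebesgue measure on R^(n+1), built as the iterated product measure  *)
(* ((R x R) x R) x ... of the one-dimensional Lebesgue measure.         *)
Section ProductMeasure.
(* The product measure m1 \x m2, with its sigma-finiteness instance
   (the library instance is shadowed by a later canonical declaration). *)
Local Open Scope ereal_scope.
Context d1 d2 (T1 : measurableType d1) (T2 : measurableType d2) (R : realType).
Variable m1 : {sigma_finite_measure set T1 -> \bar R}.
Variable m2 : {sigma_finite_measure set T2 -> \bar R}.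
Definition pmeas := (m1 \x m2)%E.
HB.instance Definition _ := Measure.on pmeas.
Lemma pmeas_sigma_finite : sigma_finite setT pmeas.
Proof.
have /sigma_finiteP[F [TF ndF Foo]] := sigma_finiteT m1.
have /sigma_finiteP[G [TG ndG Goo]] := sigma_finiteT m2.
exists (fun n => F n `*` G n).
 rewrite -setXTT TF TG predeqE => -[x y]; split.
    move=> [/= [n _ Fnx] [k _ Gky]]; exists (maxn n k) => //; split.
    - by move: x Fnx; exact/subsetPset/ndF/leq_maxl.
    - by move: y Gky; exact/subsetPset/ndG/leq_maxr.
  by move=> [n _ []/= ? ?]; split; exists n.
move=> k; have [? ?] := Foo k; have [? ?] := Goo k.
split; first exact: measurableX.
by rewrite /pmeas product_measure1E// lte_mul_pinfty// ge0_fin_numE.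
Qed.
HB.instance Definition _ := Measure_isSigmaFinite.Build _ _ _ pmeas pmeas_sigma_finite.
End ProductMeasure.

Record mspace (R : realType) := MSpace {
  ms_disp : measure_display;
  ms_car : measurableType ms_disp;
  ms_mu : {sigma_finite_measure set ms_car -> \bar R} }.

Fixpoint lebRd (R : realType) (n : nat) : mspace R :=
  match n with
  | 0 => @MSpace R _ (measurableTypeR R) (@lebesgue_measure R : {sigma_finite_measure set (measurableTypeR R) -> \bar R})
  | n'.+1 =>
    let L := lebRd R n' in
    @MSpace R _ (ms_car L * measurableTypeR R)%type
      (@pmeas _ _ _ _ R (ms_mu L) (@lebesgue_measure R)
         : {sigma_finite_measure set (ms_car L * measurableTypeR R)%type -> \bar R})
  end.

Definition Rd (R : realType) (n : nat) := ms_car (lebRd R n).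
Definition lebd (R : realType) (n : nat) := ms_mu (lebRd R n).

(* The canonical identification of the product model with row vectors
   'rV[R]_(n+1) (used to transport the topology of R^(n+1)). *)
Fixpoint vecRd (R : realType) (n : nat) : Rd R n -> 'rV[R]_n.+1 :=
  match n return Rd R n -> 'rV[R]_n.+1 with
  | 0 => fun x => \row_(i < 1) x
  | n'.+1 => fun x =>
      \row_(i < n'.+2)
        (if (i < n'.+1)%N then (@vecRd R n' x.1) 0 (inord i) else x.2)
  end.

Definition enorm (R : realType) (m : nat) (v : 'rV[R]_m) : R :=
  Num.sqrt (\sum_(i < m) v 0 i ^+ 2).

Section Functional.
Context (R : realType) (n m : nat).
Local Notation T := (Rd R n).
Local Notation mu := (lebd R n).
Variable Om : set T.

(* membership in X = L^2(Omega, R^m) (as functions; classes mod a.e.) *)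
Definition L2 (f : T -> 'rV[R]_m) : Prop :=
  (forall i : 'I_m, measurable_fun Om (fun x => f x 0 i)) /\
  (\int[mu]_(x in Om) ((enorm (f x)) ^+ 2)%:E < +oo)%E.

Definition L2inner (f g : T -> 'rV[R]_m) : \bar R :=
  (\int[mu]_(x in Om) (\sum_(i < m) f x 0 i * g x 0 i)%:E)%E.

Definition L2norm2 (f : T -> 'rV[R]_m) : \bar R :=
  (\int[mu]_(x in Om) ((enorm (f x)) ^+ 2)%:E)%E.

Definition rho (p : T -> R) (f : T -> 'rV[R]_m) : \bar R :=
  (\int[mu]_(x in Om) ((enorm (f x)) `^ (p x))%:E)%E.

Definition rho_star (p : T -> R) (g : T -> 'rV[R]_m) : \bar R :=
  ereal_sup [set (L2inner f g - rho p f)%E | f in L2].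

Definition prox_objective (F : (T -> 'rV[R]_m) -> \bar R) (tau : R)
    (f g : T -> 'rV[R]_m) : \bar R :=
  (tau%:E * F g + (2^-1)%:E * L2norm2 (fun x => (g x - f x)%R))%E.

Definition is_prox (F : (T -> 'rV[R]_m) -> \bar R) (tau : R)
    (f g : T -> 'rV[R]_m) : Prop :=
  L2 g /\ forall h, L2 h ->
    (prox_objective F tau f g <= prox_objective F tau f h)%E.

End Functional.

Definition alpha_bar (R : realType) (a q s : R) : R :=
  xget 0 [set al : R | 0 < al < a /\ al + s * q * al `^ (q - 1) = a].

Definition Vtau (R : realType) (m : nat) (tau : R) (z : 'rV[R]_m) (q : R) : R :=
  if q == 1 then Num.min (enorm z) 1
  else if q == 2 then 2 * enorm z / (tau + 2)
  else enorm z - alpha_bar (enorm z) q (tau `^ (1 - q)).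

Definition prox_formula (R : realType) (T : Type) (m : nat) (tau : R)
    (p : T -> R) (f : T -> 'rV[R]_m) : T -> 'rV[R]_m :=
  fun x => if f x == 0 then 0
           else (Vtau tau (f x) (p x) / enorm (f x)) *: f x.

(* Main.v *)
Require Import Defs.
From mathcomp Require Import all_boot all_order all_algebra.
From mathcomp Require Import all_classical all_reals all_analysis.
From mathcomp Require Import lra ring measurable_realfun.

(* The minimiser is certified by a dual vector.  Put v := prox_formula and
   u := (f - v) / tau.  Pointwise, u(x) maximises w |-> <w, v(x)> - |w|^p(x), because
   the formula for V_tau says exactly V = q U^(q-1) with U = |u(x)|, the equality case
   of Young's inequality.  Hence rho_p^*(v) <= int <u, v> - |u|^p, while
   rho_p^*(h) >= <u, h> - rho_p(u) for every h in L^2.  Since tau u = f - v, completing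
   the square turns these two bounds into
     J(h) >= J(v) + |h - v|^2 / 2,   J := tau rho_p^* + |. - f|^2 / 2,
   which gives both minimality and uniqueness almost everywhere. *)

Set Implicit Arguments.
Unset Strict Implicit.
Unset Printing Implicit Defensive.

Import Order.TTheory GRing.Theory Num.Theory.
Import numFieldNormedType.Exports.
Local Open Scope classical_set_scope.
Local Open Scope ring_scope.

Section EuclideanVectors.
Variables (R : realType) (m : nat).
Implicit Types (u v w : 'rV[R]_m).

Definition edot u w : R := \sum_(i < m) u 0 i * w 0 i.

Lemma edotC u w : edot u w = edot w u.
Proof. by apply: eq_bigr => i _; rewrite mulrC. Qed.

Lemma edotZl (c : R) u w : edot (c *: u) w = c * edot u w.
Proof. by rewrite /edot mulr_sumr; apply: eq_bigr => i _; rewrite mxE mulrA. Qed.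

Lemma edotZr (c : R) u w : edot u (c *: w) = c * edot u w.
Proof. by rewrite edotC edotZl edotC. Qed.

Lemma edotDl u v w : edot (u + v) w = edot u w + edot v w.
Proof. by rewrite /edot -big_split; apply: eq_bigr => i _; rewrite mxE mulrDl. Qed.

Lemma edotDr u v w : edot w (u + v) = edot w u + edot w v.
Proof. by rewrite edotC edotDl !(edotC w). Qed.

Lemma edot0l u : edot 0 u = 0.
Proof. by rewrite -(scale0r 0) edotZl mul0r. Qed.

Lemma edot0r u : edot u 0 = 0.
Proof. by rewrite edotC edot0l. Qed.

Lemma enorm_ge0 u : 0 <= enorm u.
Proof. exact: sqrtr_ge0. Qed.

Lemma enorm_sqr u : enorm u ^+ 2 = edot u u.
Proof.
rewrite /enorm sqr_sqrtr; last by apply: sumr_ge0 => i _; rewrite sqr_ge0.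
by apply: eq_bigr => i _; rewrite expr2.
Qed.

Lemma enorm_eq0 u : (enorm u == 0) = (u == 0).
Proof.
apply/eqP/eqP => [u0|->]; last first.
  by rewrite /enorm big1 ?sqrtr0 // => i _; rewrite mxE expr0n.
have : edot u u == 0 by rewrite -enorm_sqr u0 expr0n.
rewrite psumr_eq0 => [/allP uu0|i _]; last by rewrite -expr2 sqr_ge0.
apply/rowP => i; rewrite mxE.
by have /= := uu0 i (mem_index_enum _); rewrite -expr2 sqrf_eq0 => /eqP.
Qed.

Lemma enorm0 : enorm (0 : 'rV[R]_m) = 0.
Proof. by apply/eqP; rewrite enorm_eq0. Qed.

Lemma enorm_gt0 u : (0 < enorm u) = (u != 0).
Proof. by rewrite lt_neqAle enorm_ge0 andbT eq_sym enorm_eq0. Qed.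

Lemma enormZ (c : R) u : enorm (c *: u) = `|c| * enorm u.
Proof.
rewrite /enorm -sqrtr_sqr -sqrtrM ?sqr_ge0 // mulr_sumr.
by congr Num.sqrt; apply: eq_bigr => i _; rewrite mxE exprMn.
Qed.

Lemma edot_le u w : edot u w <= enorm u * enorm w.
Proof.
have [->|u0] := eqVneq u 0; first by rewrite edot0l enorm0 mul0r.
have [->|w0] := eqVneq w 0; first by rewrite edot0r enorm0 mulr0.
set a := enorm w; set b := enorm u.
have a0 : 0 < a by rewrite enorm_gt0.
have b0 : 0 < b by rewrite enorm_gt0.
have expand : enorm (a *: u + (- b) *: w) ^+ 2 = 2 * a * b * (a * b - edot u w).
  rewrite enorm_sqr !edotDl !edotDr !edotZl !edotZr.
  by rewrite (edotC w u) -!enorm_sqr -/a -/b; ring.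
have := sqr_ge0 (enorm (a *: u + (- b) *: w)); rewrite expand.
by rewrite pmulr_rge0 ?mulr_gt0 // subr_ge0 mulrC.
Qed.

Lemma normr_edot_le u w : `|edot u w| <= enorm u ^+ 2 + enorm w ^+ 2.
Proof.
have := edot_le u w; have := edot_le ((-1) *: u) w.
rewrite edotZl enormZ normrN normr1 mul1r => neg_le pos_le.
have := sqr_ge0 (enorm u - enorm w).
by move=> sq; rewrite ler_norml; apply/andP; split; nra.
Qed.

Lemma enormD_sqr_le u w : enorm (u + w) ^+ 2 <= 2 * enorm u ^+ 2 + 2 * enorm w ^+ 2.
Proof.
rewrite !enorm_sqr edotDl !edotDr (edotC w u) -!enorm_sqr.
have := edot_le u w; have := sqr_ge0 (enorm u - enorm w); nra.
Qed.

Lemma edot_complete_square (f v w : 'rV[R]_m) :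
  edot (f - v) w + 2^-1 * enorm (w - f) ^+ 2 =
  edot (f - v) v + 2^-1 * enorm (v - f) ^+ 2 + 2^-1 * enorm (w - v) ^+ 2.
Proof.
rewrite !enorm_sqr /edot !mulr_sumr -!big_split /=.
by apply: eq_bigr => i _; rewrite !mxE; field.
Qed.

End EuclideanVectors.

Section AlphaBar.
Variable R : realType.
Implicit Types a q s t : R.

Lemma alpha_bar_exists a q s : 0 < a -> 1 < q -> 0 < s ->
  exists al, 0 < al < a /\ al + s * q * al `^ (q - 1) = a.
Proof.
move=> a0 q1 s0.
have q0 : 0 < q by apply: lt_trans q1.
have q10 : 0 < q - 1 by rewrite subr_gt0.
pose g t := t + s * q * t `^ (q - 1).
(* IVT on [e, a], where e is small enough that s q e^(q-1) <= a / 2 *)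
pose c := a / (2 * s * q).
have c0 : 0 < c by rewrite divr_gt0 // !mulr_gt0.
have cq0 : 0 < c `^ (q - 1)^-1 by apply: powR_gt0.
pose e := Num.min (a / 2) (c `^ (q - 1)^-1 / 2).
have e0 : 0 < e by rewrite lt_min !divr_gt0.
have ea : e < a by rewrite gt_min; apply/orP; left; lra.
have ec : e `^ (q - 1) < c.
  have -> : c = (c `^ (q - 1)^-1) `^ (q - 1).
    by rewrite -powRrM mulVf ?gt_eqF // powRr1 // ltW.
  apply: gt0_ltr_powR; rewrite ?nnegrE ?ltW //.
  by rewrite gt_min; apply/orP; right; lra.
have ge : g e < a.
  have : s * q * e `^ (q - 1) < s * q * c by rewrite ltr_pM2l // mulr_gt0.
  have -> : s * q * c = a / 2 by rewrite /c; field; rewrite !gt_eqF.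
  have : e <= a / 2 by rewrite ge_min lexx.
  rewrite /g; lra.
have ga : a < g a by rewrite /g ltrDl !mulr_gt0 // powR_gt0.
have gcont : {within `[e, a], continuous g}.
  apply: derivable_within_continuous => x; rewrite in_itv /= => /andP[ex _].
  apply: derivableD => //; apply: derivableM => //.
  by apply: derivable_powR; rewrite in_itv /= andbT (lt_le_trans e0).
have [al] : exists2 al, al \in `[e, a] & g al = a.
  apply: IVT => //; first exact: ltW.
  by rewrite ge_min le_max (ltW ge) (ltW ga) orbT.
rewrite in_itv /= => /andP[eal ala] gal.
have al0 : 0 < al by apply: lt_le_trans eal.
exists al; split=> //; apply/andP; split=> //.
have : 0 < s * q * al `^ (q - 1) by rewrite !mulr_gt0 // powR_gt0.
by move: gal; rewrite /g; lra.
Qed.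

Lemma alpha_bar_spec a q s : 0 < a -> 1 < q -> 0 < s ->
  0 < alpha_bar a q s < a /\
  alpha_bar a q s + s * q * alpha_bar a q s `^ (q - 1) = a.
Proof. by move=> a0 q1 s0; apply: xgetPex (alpha_bar_exists a0 q1 s0). Qed.

Lemma alpha_bar_ge0 a q s : 0 <= alpha_bar a q s.
Proof. by rewrite /alpha_bar; case: xgetP => [x _ [/andP[/ltW]]|]. Qed.

(* t |-> t + s q t^(q-1) is increasing; for a = 0 the defining set is empty and
   alpha_bar takes the default value 0. *)
Lemma lt_alpha_bar a q s t : 0 <= a -> 1 < q -> 0 < s -> 0 <= t ->
  (t < alpha_bar a q s) = (t + s * q * t `^ (q - 1) < a).
Proof.
move=> a0 q1 s0 t0.
have sq0 : 0 < s * q by rewrite mulr_gt0 // (lt_trans _ q1).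
have powle x y : 0 <= x -> x <= y -> x `^ (q - 1) <= y `^ (q - 1).
  move=> x0 xy; apply: ge0_ler_powR; rewrite ?nnegrE ?subr_ge0 ?(ltW q1) //.
  exact: le_trans xy.
have mono x y : 0 <= x -> x <= y ->
    x + s * q * x `^ (q - 1) <= y + s * q * y `^ (q - 1).
  by move=> x0 xy; rewrite lerD // ler_pM2l // powle.
move: a0; rewrite le_eqVlt => /predU1P[<-|a_gt0].
  rewrite /alpha_bar xgetPN => [|x [/andP[x0 /(lt_trans x0)]]]; last by rewrite ltxx.
  have q10 : q - 1 != 0 by rewrite subr_eq0 gt_eqF.
  have := mono 0 t (lexx 0) t0; rewrite powR0 // mulr0 addr0.
  by move=> h; rewrite !ltNge t0 h.
have [/andP[al0 ala] alE] := alpha_bar_spec a_gt0 q1 s0.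
apply/idP/idP => [tal|].
  rewrite -[ltRHS]alE; apply: ltr_leD => //.
  by rewrite ler_pM2l // powle // ltW.
apply: contraTT; rewrite -!leNgt => alt.
by rewrite -[leLHS]alE mono // ltW.
Qed.

End AlphaBar.

Section ConjugateExponent.
Variable R : realType.

(* Young's inequality r V <= r^q + (q - 1) U^q, with equality at r = U. *)
Lemma powR_conj_max (q U r : R) : 1 < q -> 0 <= U -> 0 <= r ->
  r * (q * U `^ (q - 1)) - r `^ q <= U * (q * U `^ (q - 1)) - U `^ q.
Proof.
move=> q1 U0 r0.
have q0 : 0 < q by apply: lt_trans q1.
have q10 : 0 < q - 1 by rewrite subr_gt0.
have qq : q^-1 + (q / (q - 1))^-1 = 1 by rewrite invf_div; field; rewrite gt_eqF.
have := conjugate_powR r0 (powR_ge0 U (q - 1)) q0 (divr_gt0 q0 q10) qq.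
rewrite -powRrM (_ : (q - 1) * (q / (q - 1)) = q); last by field; rewrite gt_eqF.
rewrite invf_div -(ler_pM2l q0) => young.
rewrite [U * _]mulrCA mulr_powRB1 // [r * _]mulrCA.
have expand : q * (r `^ q / q + U `^ q * ((q - 1) / q)) = r `^ q + (q - 1) * U `^ q.
  by field; rewrite gt_eqF.
rewrite expand in young; lra.
Qed.

Lemma powR1_conj_max (V U r : R) : V <= 1 -> 0 <= U -> U * (1 - V) = 0 ->
  0 <= r -> r * V - r `^ 1 <= U * V - U `^ 1.
Proof. by move=> V1 U0 UV r0; rewrite !powRr1 //; nra. Qed.

End ConjugateExponent.

Section ProxPoint.
Variables (R : realType) (m : nat) (tau : R).
Hypothesis tau_gt0 : 0 < tau.
Implicit Types (z w : 'rV[R]_m) (q : R).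

(* In each case V = q U^(q-1) (degenerately for q = 1), where U = (|z| - V) / tau
   is the length of the dual vector (z - prox z) / tau. *)
Lemma Vtau_spec z q : 0 < enorm z -> 1 <= q <= 2 ->
  0 <= Vtau tau z q <= enorm z /\
  forall r, 0 <= r ->
    r * Vtau tau z q - r `^ q <=
    (enorm z - Vtau tau z q) / tau * Vtau tau z q
      - ((enorm z - Vtau tau z q) / tau) `^ q.
Proof.
move=> a0 /andP[q1 q2]; rewrite /Vtau; set a := enorm z in a0 *.
have [->|qn1] := eqVneq q 1; rewrite ?eqxx.
  have [a1|a1] := leP a 1.
    rewrite subrr mul0r; split=> [|r r0]; first by rewrite lexx ltW.
    by apply: powR1_conj_max; rewrite ?mul0r.
  split=> [|r r0]; first by rewrite ler01 ltW.
  by apply: powR1_conj_max; rewrite ?subrr ?mulr0 // divr_ge0 ?subr_ge0 ?ltW.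
have q1' : 1 < q by rewrite lt_neqAle eq_sym qn1.
have [->|qn2] := eqVneq q 2; rewrite ?eqxx.
  have t2 : 0 < tau + 2 by rewrite addr_gt0.
  have UE : (a - 2 * a / (tau + 2)) / tau = a / (tau + 2).
    by field; rewrite !gt_eqF.
  have VE : 2 * a / (tau + 2) = 2 * (a / (tau + 2)) `^ (2 - 1).
    by rewrite (_ : 2 - 1 = 1) ?powRr1 ?mulrA ?divr_ge0 ?ltW //; lra.
  rewrite UE; split=> [|r r0].
    apply/andP; split; first by rewrite divr_ge0 ?mulr_ge0 ?ltW.
    rewrite ler_pdivrMr // -subr_ge0.
    by rewrite (_ : _ - _ = a * tau) ?mulr_ge0 ?ltW //; ring.
  by rewrite VE; apply: powR_conj_max; rewrite // ?divr_ge0 ?ltW //; lra.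
have s0 : 0 < tau `^ (1 - q) by apply: powR_gt0.
have [/andP[al0 ala] alE] := alpha_bar_spec a0 q1' s0.
set al := alpha_bar _ _ _ in al0 ala alE *.
rewrite (_ : a - (a - al) = al); last by rewrite opprB addrC subrK.
have VE : a - al = q * (al / tau) `^ (q - 1).
  rewrite powRM ?ltW ?invr_gt0 // -powR_inv1 ?ltW // -powRrM.
  rewrite (_ : -1 * (q - 1) = 1 - q); last by ring.
  lra.
split=> [|r r0]; first by apply/andP; split; lra.
by rewrite VE; apply: powR_conj_max => //; rewrite divr_ge0 ?ltW.
Qed.

Definition prox_point z q : 'rV[R]_m :=
  if z == 0 then 0 else (Vtau tau z q / enorm z) *: z.

Definition dual_point z q : 'rV[R]_m := tau^-1 *: (z - prox_point z q).

Lemma enorm_prox_point_le z q : 1 <= q <= 2 -> enorm (prox_point z q) <= enorm z.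
Proof.
move=> q12; rewrite /prox_point; case: eqVneq => [->|z0]; first by rewrite enorm0.
have a0 : 0 < enorm z by rewrite enorm_gt0.
have [/andP[V0 Va] _] := Vtau_spec a0 q12.
by rewrite enormZ ger0_norm ?divr_ge0 ?enorm_ge0 // divfK ?gt_eqF.
Qed.

Lemma prox_point_fenchel z q w : 1 <= q <= 2 ->
  edot w (prox_point z q) - enorm w `^ q <=
  edot (dual_point z q) (prox_point z q) - enorm (dual_point z q) `^ q.
Proof.
move=> q12; have q0 : q != 0 by case/andP: q12 => q1 _; rewrite gt_eqF // (lt_le_trans _ q1).
rewrite /dual_point /prox_point; case: eqVneq => [->|z0].
  by rewrite subrr scaler0 enorm0 powR0 // !edot0r subr0 sub0r lerNl oppr0 powR_ge0.
have a0 : 0 < enorm z by rewrite enorm_gt0.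
have [/andP[V0 Va] conj_max] := Vtau_spec a0 q12.
set a := enorm z in a0 V0 Va conj_max *; set V := Vtau tau z q in V0 Va conj_max *.
set l := V / a.
have -> : tau^-1 *: (z - l *: z) = ((1 - l) / tau) *: z.
  by rewrite -{1}(scale1r z) -scalerBl scalerA mulrC.
rewrite !edotZr edotZl -enorm_sqr enormZ -/a.
have l0 : 0 <= l by rewrite divr_ge0 // ltW.
have l1 : 0 <= 1 - l by rewrite subr_ge0 ler_pdivrMr // mul1r.
have UE : `|(1 - l) / tau| * a = (a - V) / tau.
  rewrite ger0_norm; last by rewrite divr_ge0 // ltW.
  by rewrite /l; field; rewrite !gt_eqF.
have dotE : l * ((1 - l) / tau * a ^+ 2) = (a - V) / tau * V.
  by rewrite /l; field; rewrite !gt_eqF.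
rewrite UE dotE.
have : l * edot w z <= enorm w * V.
  have -> : enorm w * V = l * (enorm w * a) by rewrite /l; field; rewrite gt_eqF.
  by rewrite ler_wpM2l // edot_le.
have := conj_max (enorm w) (enorm_ge0 w).
lra.
Qed.

End ProxPoint.

Section Measurability.
Context d (T : measurableType d) (R : realType) (D : set T).
Hypothesis mD : measurable D.

Lemma measurable_fun_if_dom (b : T -> bool) (f g : T -> R) :
  measurable_fun D b -> measurable_fun D f -> measurable_fun D g ->
  measurable_fun D (fun x => if b x then f x else g x).
Proof.
move=> mb mf mg; apply: measurable_fun_if => //.
  by apply: measurable_funS mf => //; exact: subIsetl.
by apply: measurable_funS mg => //; exact: subIsetl.
Qed.

Lemma measurable_fun_powR (a b : T -> R) :
  measurable_fun D a -> measurable_fun D b ->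
  measurable_fun D (fun x => a x `^ b x).
Proof.
move=> ma mb; rewrite /powR; apply: measurable_fun_if_dom.
- exact: measurable_fun_eqr.
- have -> : (fun x => ((b x == 0)%:R : R)) = (fun x => if b x == 0 then 1 else 0).
    by apply: funext => x; case: (b x == 0).
  by apply: measurable_fun_if_dom => //; exact: measurable_fun_eqr.
- apply: measurableT_comp; first exact: measurable_expR.
  by apply: measurable_funM => //; apply: measurableT_comp => //; exact: measurable_ln.
Qed.

Variable m : nat.
Implicit Types g h : T -> 'rV[R]_m.

Lemma measurable_enorm g : (forall i, measurable_fun D (fun x => g x 0 i)) ->
  measurable_fun D (fun x => enorm (g x)).
Proof.
move=> mg; apply: (measurableT_comp (f := @Num.sqrt R)).
  exact: continuous_measurable_fun (@sqrt_continuous R).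
by apply: measurable_sum => i; apply: measurable_funX.
Qed.

Lemma measurable_edot g h : (forall i, measurable_fun D (fun x => g x 0 i)) ->
  (forall i, measurable_fun D (fun x => h x 0 i)) ->
  measurable_fun D (fun x => edot (g x) (h x)).
Proof. by move=> mg mh; apply: measurable_sum => i; exact: measurable_funM. Qed.

Lemma measurable_alpha_bar (a q : T -> R) (tau : R) : 0 < tau ->
  measurable_fun D a -> measurable_fun D q ->
  (forall x, D x -> 0 <= a x /\ 1 < q x) ->
  measurable_fun D (fun x => alpha_bar (a x) (q x) (tau `^ (1 - q x))).
Proof.
move=> tau0 ma mq aq; apply: (measurability _ (RGenOInfty.measurableE R)) => //.
move=> /= _ [_ [t ->] <-]; rewrite preimage_itvoy.
have [t0|t0] := ltP t 0.
  rewrite (_ : _ `&` _ = D) //; apply/seteqP; split=> [x [] //|x Dx].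
  split=> //=; exact: (lt_le_trans t0 (@alpha_bar_ge0 R _ _ _)).
have mG : measurable_fun D (fun x => t + tau `^ (1 - q x) * q x * t `^ (q x - 1)).
  apply: measurable_funD => //; apply: measurable_funM; first apply: measurable_funM => //.
    apply: measurableT_comp; first exact: measurable_powRr.
    exact: measurable_funB.
  apply: measurableT_comp; first exact: measurable_powRr.
  exact: measurable_funB.
have := measurable_funB ma mG mD (measurable_itv `]0, +oo[).
congr measurable; apply/seteqP; split=> x [Dx /=];
  rewrite in_itv /= andbT subr_gt0 => h; split => //; have [a0 q1] := aq x Dx.
  by rewrite lt_alpha_bar // powR_gt0.
by move: h; rewrite lt_alpha_bar // powR_gt0.
Qed.

End Measurability.

Section MeasurableProxPoint.
Context d (T : measurableType d) (R : realType) (D : set T) (m : nat).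
Hypothesis mD : measurable D.
Variable tau : R.
Hypothesis tau_gt0 : 0 < tau.
Variable q : T -> R.
Hypotheses (mq : measurable_fun D q) (q12 : forall x, D x -> 1 <= q x <= 2).

Lemma measurable_Vtau (g : T -> 'rV[R]_m) :
  (forall i, measurable_fun D (fun x => g x 0 i)) ->
  measurable_fun D (fun x => Vtau tau (g x) (q x)).
Proof.
move=> mg; have mn := measurable_enorm mg; rewrite /Vtau.
apply: measurable_fun_if => //; first exact: measurable_fun_eqr.
  by apply: measurable_funS (measurable_minr mn (measurable_cst (1 : R))).
have mD1 : measurable (D `&` (fun x => q x == 1) @^-1` [set false]).
  exact: (measurable_fun_eqr mq (measurable_cst (1 : R))).
apply: measurable_fun_if => //.
- by apply: measurable_funS (measurable_fun_eqr mq (measurable_cst (2 : R))).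
- apply: measurable_funS (_ : measurable_fun D (fun x => 2 * enorm (g x) / (tau + 2))) => //.
    by move=> x [[]].
  by apply: measurable_funM => //; exact: measurable_funM.
have mD2 : measurable (D `&` (fun x => q x == 1) @^-1` [set false]
                         `&` (fun x => q x == 2) @^-1` [set false]).
  apply: (measurable_fun_eqr _ (measurable_cst (2 : R))) => //.
  by apply: measurable_funS mq => //; exact: subIsetl.
apply: measurable_funB; first by apply: measurable_funS mn => // x [[]].
apply: measurable_alpha_bar => //.
- by apply: measurable_funS mn => // x [[]].
- by apply: measurable_funS mq => // x [[]].
move=> x [[Dx /= /negbT qn1] /= /negbT qn2]; split; first exact: enorm_ge0.
by have := q12 Dx; rewrite lt_neqAle eq_sym qn1 => /andP[].
Qed.

Lemma measurable_prox_point (g : T -> 'rV[R]_m) :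
  (forall i, measurable_fun D (fun x => g x 0 i)) ->
  forall i, measurable_fun D (fun x => prox_point tau (g x) (q x) 0 i).
Proof.
move=> mg i; have mn := measurable_enorm mg.
apply: (eq_measurable_fun (fun x => if enorm (g x) == 0 then 0
    else Vtau tau (g x) (q x) * enorm (g x) `^ (-1) * g x 0 i)).
  move=> x _; rewrite /prox_point enorm_eq0.
  by case: eqP => [_|_]; rewrite mxE ?powR_inv1 ?enorm_ge0.
apply: measurable_fun_if_dom => //; first exact: measurable_fun_eqr.
apply: measurable_funM => //; apply: measurable_funM; first exact: measurable_Vtau.
exact: measurable_fun_powR.
Qed.

End MeasurableProxPoint.

Lemma measurable_vecRd_coord (R : realType) (n : nat) (i : 'I_n.+1) :
  measurable_fun setT (fun x : Rd R n => vecRd x 0 i).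
Proof.
elim: n i => [|n IH] i /=.
  by apply: (eq_measurable_fun id) => // x _; rewrite mxE.
have [ilt|ige] := ltnP i n.+1.
  apply: (eq_measurable_fun ((fun x : Rd R n => vecRd x 0 (inord i)) \o fst)).
    by move=> x _; rewrite mxE ilt.
  exact: measurableT_comp.
apply: (eq_measurable_fun snd); first by move=> x _; rewrite mxE ltnNge ige.
exact: measurable_snd.
Qed.

Section OpenMeasurable.
Variables (R : realType) (n : nat).

Definition rat_box (s : {ffun 'I_n.+1 -> rat * rat}) : set (Rd R n) :=
  [set x | forall i, ratr (s i).1 < vecRd x 0 i < ratr (s i).2].

Lemma measurable_rat_box s : measurable (rat_box s).
Proof.
have -> : rat_box s = \bigcap_(i in [set: 'I_n.+1])
    (fun x => vecRd x 0 i) @^-1` `]ratr (s i).1, ratr (s i).2[.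
  by apply/seteqP; split=> x sx i => [_|]; [rewrite /= in_itv; exact: sx | have := sx i I].
apply: fin_bigcap_measurable => [|i _]; first exact: finite_finset.
by rewrite -[X in measurable X]setTI; exact: measurable_vecRd_coord.
Qed.

(* An open set is the countable union of the rational boxes it contains. *)
Lemma measurable_vecRd_open (U : set 'rV[R]_n.+1) :
  open U -> measurable (@vecRd R n @^-1` U).
Proof.
move=> oU; set P := _ @^-1` U.
have -> : P = \bigcup_(s : {ffun 'I_n.+1 -> rat * rat})
    (if `[< rat_box s `<=` P >] then rat_box s else set0).
  apply/seteqP; split=> [x Px|x [s _]]; last by case: asboolP => // sP /sP.
  have /nbhs_ballP[e /= e0 xeU] : nbhs (vecRd x) U by exact: oU.
  have [a ax] := choice (fun i => @rat_in_itvoo R (vecRd x 0 i - e) (vecRd x 0 i)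
    ltac:(by rewrite ltrBlDr ltrDl)).
  have [b xb] := choice (fun i => @rat_in_itvoo R (vecRd x 0 i) (vecRd x 0 i + e)
    ltac:(by rewrite ltrDl)).
  pose s := [ffun i => (a i, b i)].
  have sP : rat_box s `<=` P.
    move=> y sy; apply: xeU; split=> // i j; rewrite (ord1 i) /=.
    have := sy j; have := ax j; have := xb j; rewrite !ffunE !in_itv /=.
    move=> /andP[? ?] /andP[? ?] /andP[? ?].
    by rewrite /ball /= ltr_norml; apply/andP; split; lra.
  exists s => //; case: asboolP => // _ i.
  by have := ax i; have := xb i; rewrite !ffunE !in_itv /= => /andP[-> _] /andP[_ ->].
apply: countable_bigcupT_measurable => [|s]; first exact: countableP.
by case: asboolP => // _; exact: measurable_rat_box.
Qed.

End OpenMeasurable.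

Section L2Space.
Variables (R : realType) (n m : nat) (Om : set (Rd R n)).
Hypothesis mOm : measurable Om.
Local Notation mu := (lebd R n).
Local Notation T := (Rd R n).
Implicit Types g h : T -> 'rV[R]_m.

Lemma measurable_enorm_L2 g : L2 Om g -> measurable_fun Om (fun x => enorm (g x)).
Proof. by case=> mg _; exact: measurable_enorm. Qed.

Let integral_abs_enorm_sqr g :
  (\int[mu]_(x in Om) `|(enorm (g x) ^+ 2)%:E| = \int[mu]_(x in Om) (enorm (g x) ^+ 2)%:E)%E.
Proof. by apply: eq_integral => x _; rewrite gee0_abs // lee_fin sqr_ge0. Qed.

Lemma integrable_enorm_sqr g : L2 Om g ->
  mu.-integrable Om (EFin \o (fun x => enorm (g x) ^+ 2)).
Proof.
move=> Lg; apply/integrableP; split; last by rewrite integral_abs_enorm_sqr; case: Lg.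
by apply: measurableT_comp => //; apply: measurable_funX; exact: measurable_enorm_L2.
Qed.

Lemma integrable_abs_le (h G : T -> R) :
  measurable_fun Om h -> mu.-integrable Om (EFin \o G) ->
  (forall x, Om x -> `|h x| <= G x) -> mu.-integrable Om (EFin \o h).
Proof.
move=> mh iG hG; apply: le_integrable iG => //; first exact: measurableT_comp.
by move=> x Ox /=; rewrite lee_fin (le_trans (hG x Ox)) // ler_norm.
Qed.

Lemma L2_le g (G : T -> R) : (forall i, measurable_fun Om (fun x => g x 0 i)) ->
  mu.-integrable Om (EFin \o G) -> (forall x, Om x -> enorm (g x) ^+ 2 <= G x) ->
  L2 Om g.
Proof.
move=> mg iG gG; split=> //.
have ig : mu.-integrable Om (EFin \o (fun x => enorm (g x) ^+ 2)).
  apply: integrable_abs_le iG _ => [|x Ox]; first exact: measurable_funX (measurable_enorm mg).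
  by rewrite ger0_norm ?sqr_ge0 ?gG.
by case/integrableP: ig => _; rewrite integral_abs_enorm_sqr.
Qed.

Lemma L2D g h : L2 Om g -> L2 Om h -> L2 Om (fun x => g x + h x).
Proof.
move=> Lg Lh; apply: (@L2_le _ (fun x => 2 * enorm (g x) ^+ 2 + 2 * enorm (h x) ^+ 2)).
- move=> i; apply: (eq_measurable_fun (fun x => g x 0 i + h x 0 i)).
    by move=> x _; rewrite mxE.
  by apply: measurable_funD; [exact: Lg.1 | exact: Lh.1].
- exact: (integrableD mOm (integrableZl mOm 2 (integrable_enorm_sqr Lg))
                          (integrableZl mOm 2 (integrable_enorm_sqr Lh))).
- by move=> x _; exact: enormD_sqr_le.
Qed.

Lemma L2Z (k : R) g : L2 Om g -> L2 Om (fun x => k *: g x).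
Proof.
move=> Lg; apply: (@L2_le _ (fun x => k ^+ 2 * enorm (g x) ^+ 2)).
- move=> i; apply: (eq_measurable_fun (fun x => k * g x 0 i)).
    by move=> x _; rewrite mxE.
  by apply: measurable_funM => //; exact: Lg.1.
- exact: (integrableZl mOm _ (integrable_enorm_sqr Lg)).
- by move=> x _; rewrite enormZ exprMn real_normK ?num_real.
Qed.

Lemma L2B g h : L2 Om g -> L2 Om h -> L2 Om (fun x => g x - h x).
Proof.
move=> Lg Lh; have := L2D Lg (L2Z (-1) Lh).
by under [X in L2 _ X -> _]eq_fun do rewrite scaleN1r.
Qed.

Lemma integrable_edot g h : L2 Om g -> L2 Om h ->
  mu.-integrable Om (EFin \o (fun x => edot (g x) (h x))).
Proof.
move=> Lg Lh; apply: (integrable_abs_le (G := fun x => enorm (g x) ^+ 2 + enorm (h x) ^+ 2)).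
- by apply: measurable_edot; [exact: Lg.1 | exact: Lh.1].
- exact: (integrableD mOm (integrable_enorm_sqr Lg) (integrable_enorm_sqr Lh)).
- by move=> x _; exact: normr_edot_le.
Qed.

Lemma L2norm2_eq0 g : L2 Om g -> L2norm2 Om g = 0%E -> {ae mu, forall x, Om x -> g x = 0}.
Proof.
move=> Lg g0.
have mg2 : measurable_fun Om (fun x => (enorm (g x) ^+ 2)%:E).
  by apply: measurableT_comp => //; apply: measurable_funX; exact: measurable_enorm_L2.
have : ae_eq mu Om (fun x => (enorm (g x) ^+ 2)%:E) (cst 0%E).
  by apply/(ae_eq_integral_abs mu mOm mg2); rewrite integral_abs_enorm_sqr.
apply: filterS => x gx0 Ox; have [] := gx0 Ox.
by move/eqP; rewrite sqrf_eq0 enorm_eq0 => /eqP.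
Qed.

End L2Space.

Section ProxRhoStar.
Variables (R : realType) (n m : nat) (Om : set (Rd R n)).
Hypothesis mOm : measurable Om.
Variables (p : Rd R n -> R) (tau : R) (f : Rd R n -> 'rV[R]_m).
Hypotheses (mp : measurable_fun Om p) (p12 : forall x, Om x -> 1 <= p x <= 2).
Hypotheses (tau_gt0 : 0 < tau) (Lf : L2 Om f).
Local Notation mu := (lebd R n).
Local Notation T := (Rd R n).

Let v x := prox_point tau (f x) (p x).
Let u x := dual_point tau (f x) (p x).
Let dual_gap x := edot (u x) (v x) - enorm (u x) `^ p x.

Let L2_prox : L2 Om v.
Proof.
apply: (@L2_le _ _ _ _ mOm _ (fun x => enorm (f x) ^+ 2)).
- by apply: measurable_prox_point => //; exact: Lf.1.
- exact: integrable_enorm_sqr.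
- move=> x Ox; rewrite lerXn2r ?nnegrE ?enorm_ge0 //.
  exact: enorm_prox_point_le (p12 Ox).
Qed.

Let L2_dual : L2 Om u.
Proof. exact: (L2Z mOm tau^-1 (L2B mOm Lf L2_prox)). Qed.

Let dual_gap_max x w : Om x -> edot w (v x) - enorm w `^ p x <= dual_gap x.
Proof. by move=> Ox; exact: prox_point_fenchel (p12 Ox). Qed.

Let powR_dual_le x : Om x -> enorm (u x) `^ p x <= edot (u x) (v x).
Proof.
move=> Ox; have p0 : p x != 0.
  by case/andP: (p12 Ox) => p1 _; rewrite gt_eqF // (lt_le_trans _ p1).
by have := dual_gap_max 0 Ox; rewrite edot0l enorm0 powR0 // subrr subr_ge0.
Qed.

Let integrable_dual_pow : mu.-integrable Om (EFin \o (fun x => enorm (u x) `^ p x)).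
Proof.
apply: (@integrable_abs_le _ _ _ mOm _ (fun x => enorm (u x) ^+ 2 + enorm (v x) ^+ 2)).
- by apply: measurable_fun_powR => //; exact: measurable_enorm_L2.
- exact: (integrableD mOm (integrable_enorm_sqr L2_dual) (integrable_enorm_sqr L2_prox)).
move=> x Ox; rewrite ger0_norm ?powR_ge0 //.
by rewrite (le_trans (powR_dual_le Ox)) // (le_trans (ler_norm _)) // normr_edot_le.
Qed.

Let integrable_dual_gap : mu.-integrable Om (EFin \o dual_gap).
Proof. exact: (integrableB mOm (integrable_edot mOm L2_dual L2_prox) integrable_dual_pow). Qed.

Let rho_star_prox_le : (rho_star Om p v <= \int[mu]_(x in Om) (dual_gap x)%:E)%E.
Proof.
apply: ge_ereal_sup => _ [w Lw <-].
have [rw_oo|rw_fin] := eqVneq (rho Om p w) +oo%E; first by rewrite rw_oo addeNy leNye.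
have iw : mu.-integrable Om (EFin \o (fun x => enorm (w x) `^ p x)).
  apply/integrableP; split.
    apply: measurableT_comp => //.
    by apply: measurable_fun_powR => //; exact: measurable_enorm_L2.
  rewrite lt_neqAle leey andbT; apply: contra_neq rw_fin => <-.
  by apply: eq_integral => x _ /=; rewrite ger0_norm ?powR_ge0.
rewrite leeBlDl ?(integrable_fin_num mOm iw) //.
rewrite -(integralD_EFin mOm iw integrable_dual_gap).
apply: le_integral => //; first exact: integrable_edot.
- exact: (integrableD mOm iw integrable_dual_gap).
- by move=> x /[1!inE] Ox; rewrite lee_fin -lerBlDl; exact: dual_gap_max.
Qed.

Let min_density x := tau * dual_gap x + 2^-1 * enorm (v x - f x) ^+ 2.

Let integrable_gap_term : mu.-integrable Om (EFin \o (fun x => tau * dual_gap x)).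
Proof. exact: (integrableZl mOm tau integrable_dual_gap). Qed.

Let integrable_dist_term :
  mu.-integrable Om (EFin \o (fun x => 2^-1 * enorm (v x - f x) ^+ 2)).
Proof. exact: (integrableZl mOm 2^-1 (integrable_enorm_sqr (L2B mOm L2_prox Lf))). Qed.

Let integrable_min_density : mu.-integrable Om (EFin \o min_density).
Proof. exact: (integrableD mOm integrable_gap_term integrable_dist_term). Qed.

Let prox_objective_prox_le :
  (prox_objective Om (rho_star Om p) tau f v <= \int[mu]_(x in Om) (min_density x)%:E)%E.
Proof.
rewrite (integralD_EFin mOm integrable_gap_term integrable_dist_term) /=.
rewrite (integralZl mOm integrable_dual_gap).
rewrite (integralZl mOm (integrable_enorm_sqr (L2B mOm L2_prox Lf))).
by rewrite leeD2r // lee_wpmul2l // lee_fin ltW.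
Qed.

Let dual_objective_le h : L2 Om h ->
  (tau%:E * (L2inner Om u h - rho Om p u) + (2^-1)%:E * L2norm2 Om (fun x => (h x - f x)%R)
    <= prox_objective Om (rho_star Om p) tau f h)%E.
Proof.
move=> Lh; apply: leeD2r; apply: lee_wpmul2l; first by rewrite lee_fin ltW.
by apply: ereal_sup_ubound; exists u.
Qed.

(* Completing the square around v, using tau u = f - v. *)
Let dual_objective_eq h : L2 Om h ->
  (tau%:E * (L2inner Om u h - rho Om p u) + (2^-1)%:E * L2norm2 Om (fun x => (h x - f x)%R)
   = \int[mu]_(x in Om) (min_density x)%:E
     + (2^-1)%:E * L2norm2 Om (fun x => (h x - v x)%R))%E.
Proof.
move=> Lh; have iuh := integrable_edot mOm L2_dual Lh.
have iB : mu.-integrable Om (EFin \o (fun x => edot (u x) (h x) - enorm (u x) `^ p x)).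
  exact: (integrableB mOm iuh integrable_dual_pow).
have itB : mu.-integrable Om
    (EFin \o (fun x => tau * (edot (u x) (h x) - enorm (u x) `^ p x))).
  exact: (integrableZl mOm tau iB).
have ihf := integrable_enorm_sqr (L2B mOm Lh Lf).
have ihf2 : mu.-integrable Om (EFin \o (fun x => 2^-1 * enorm (h x - f x) ^+ 2)).
  exact: (integrableZl mOm 2^-1 ihf).
have ihv := integrable_enorm_sqr (L2B mOm Lh L2_prox).
have ihv2 : mu.-integrable Om (EFin \o (fun x => 2^-1 * enorm (h x - v x) ^+ 2)).
  exact: (integrableZl mOm 2^-1 ihv).
have square x : tau * (edot (u x) (h x) - enorm (u x) `^ p x)
      + 2^-1 * enorm (h x - f x) ^+ 2 = min_density x + 2^-1 * enorm (h x - v x) ^+ 2.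
  rewrite /min_density /dual_gap /u /dual_point !edotZl !mulrBr !mulrA mulfV ?gt_eqF //.
  by have := edot_complete_square (f x) (v x) (h x); rewrite !mul1r /dual_point; lra.
rewrite /L2norm2 -(integralZl mOm ihv) -(integralZl mOm ihf).
rewrite -(integralD_EFin mOm integrable_min_density ihv2).
rewrite /L2inner /rho -(integralB_EFin mOm iuh integrable_dual_pow).
rewrite -(integralZl mOm iB) -(integralD_EFin mOm itB ihf2).
by apply: eq_integral => x _ /=; rewrite -!EFinD square.
Qed.

Let prox_objective_ge h : L2 Om h ->
  (\int[mu]_(x in Om) (min_density x)%:E + (2^-1)%:E * L2norm2 Om (fun x => (h x - v x)%R)
    <= prox_objective Om (rho_star Om p) tau f h)%E.
Proof. by move=> Lh; rewrite -dual_objective_eq //; exact: dual_objective_le. Qed.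

Lemma is_prox_rho_star_prox_formula : is_prox Om (rho_star Om p) tau f (prox_formula tau p f).
Proof.
split=> // h Lh; apply: le_trans prox_objective_prox_le _.
apply: le_trans (prox_objective_ge Lh); rewrite leeDl // mule_ge0 ?lee_fin ?invr_ge0 //.
by apply: integral_ge0 => x _; rewrite lee_fin sqr_ge0.
Qed.

Lemma is_prox_rho_star_uniq g : is_prox Om (rho_star Om p) tau f g ->
  {ae mu, forall x, Om x -> g x = prox_formula tau p f x}.
Proof.
case=> Lg g_min.
have Afin := integrable_fin_num mOm integrable_min_density.
set N := L2norm2 Om (fun x => (g x - v x)%R).
have N_ge0 : (0 <= N)%E by apply: integral_ge0 => x _; rewrite lee_fin sqr_ge0.
have N_le0 : (N <= 0)%E.
  have := le_trans (prox_objective_ge Lg) (le_trans (g_min v L2_prox) prox_objective_prox_le).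
  by rewrite -leeBrDl // subee // pmule_rle0 // lte_fin invr_gt0.
have N0 : N = 0%E by apply/le_anti; rewrite N_le0 N_ge0.
have := L2norm2_eq0 mOm (L2B mOm Lg L2_prox) N0.
by apply: filterS => x gv0 Ox; apply/eqP; rewrite -subr_eq0 gv0.
Qed.

End ProxRhoStar.

Unset Implicit Arguments.

Theorem mainTheorem6 (R : realType) (n m : nat) (Omega : set 'rV[R]_n.+1)
  (p : Rd R n -> R) (tau : R) (f : Rd R n -> 'rV[R]_m) :
  open Omega -> connected Omega -> (0 < m)%N ->
  measurable_fun (@vecRd R n @^-1` Omega) p ->
  (forall x, (@vecRd R n @^-1` Omega) x -> 1 <= p x <= 2) ->
  0 < tau ->
  L2 (@vecRd R n @^-1` Omega) f ->
  is_prox (@vecRd R n @^-1` Omega) (rho_star (@vecRd R n @^-1` Omega) p) tau f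
    (prox_formula tau p f) /\
  (forall g, is_prox (@vecRd R n @^-1` Omega) (rho_star (@vecRd R n @^-1` Omega) p) tau f g ->
     {ae lebd R n, forall x, (@vecRd R n @^-1` Omega) x -> g x = prox_formula tau p f x}).
Proof.
move=> oOmega _ _ mp p12 tau_gt0 Lf.
have mOm := measurable_vecRd_open oOmega.
split; [exact: is_prox_rho_star_prox_formula | exact: is_prox_rho_star_uniq].
Qed.
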